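(* Let $k$ be a field, $G=\mathrm{GL}_3\times\mathrm{GL}_2\times\mathrm{GL}_2\times\mathrm{GL}_2$, $V=\wedge^2\mathbb{A}^3\otimes\mathbb{A}^2\oplus\mathbb{A}^3\otimes\mathrm{M}_2$, with the action of $G$, the map $\Phi:V\to\mathbb{A}^2\otimes\mathrm{M}_2\cong\mathbb{A}^2\otimes\mathbb{A}^2\otimes\mathbb{A}^2$ and the polynomials $P_1,P_2$ described in the context, and let $U=\{x\in V\mid P_1(x),P_2(x)\neq0\}$. Then the map $\Phi$ induces a bijective correspondence $$G_k\backslash U_k\cong\mathrm{GL}_2(k)^3\backslash(k^2\otimes k^2\otimes k^2)^{\mathrm{ss}}\cong\mathrm{Ex}_2(k).$$
   Context: $\mathrm{Ex}_2(k)$ is the set of conjugacy classes of homomorphisms $\mathrm{Gal}(k^{\mathrm{sep}}/k)\to\mathfrak{S}_2$, i.e. the set of $k$-isomorphism classes of separable extensions of $k$ of degree at most $2$. Let $p_1,p_2,p_3$ be the standard basis of $\mathbb{A}^3$ and $E_{ij}$ the matrix units of $\mathrm{M}_2$ ($2\times2$ matrices, identified with $\mathbb{A}^2\otimes\mathbb{A}^2$). $g=(g_1,g_2,g_3,g_4)\in G$ acts on $\wedge^2\mathbb{A}^3\otimes\mathbb{A}^2$ by $(\wedge^2g_1,g_4)$, and on $\mathbb{A}^3\otimes\mathrm{M}_2$ by $g_1$ on $\mathbb{A}^3$ and $M\mapsto g_2M\,{}^tg_3$ on $\mathrm{M}_2$. $\Phi:V\to\mathbb{A}^2\otimes\mathrm{M}_2$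 is linear in each of the two summands of $V$ with $\Phi(v_1\otimes v_2,v_3\otimes v_4)=(v_1\wedge v_3)\,v_2\otimes v_4$ for $v_1\in\wedge^2\mathbb{A}^3$, $v_2\in\mathbb{A}^2$, $v_3\in\mathbb{A}^3$, $v_4\in\mathrm{M}_2$, where $\wedge^3\mathbb{A}^3\cong\mathbb{A}^1$ via $p_1\wedge p_2\wedge p_3\mapsto1$. For a pair $(M_1,M_2)\in\mathbb{A}^2\otimes\mathrm{M}_2$ let $F(v)=\det(v_1M_1+v_2M_2)$, a binary quadratic form in $v=(v_1,v_2)$. $(k^2\otimes k^2\otimes k^2)^{\mathrm{ss}}$ is the set of pairs for which the discriminant of $F$ is non-zero, and its $\mathrm{GL}_2(k)^3$-orbits (natural action) correspond bijectively to $\mathrm{Ex}_2(k)$ by associating the field generated by the roots of $F$. $P_1(x)$ is the discriminant of the form $F$ attached to $\Phi(x)$. $P_2(x)$ is the (unique) homogeneous degree $6$ polynomial of the $\mathbb{A}^3\otimes\mathrm{M}_2$-component $B=p_1\otimes B_1+p_2\otimes B_2+p_3\otimes B_3$ of $x$ with $P_2(gx)=(\det g_1)^2(\det g_2)^3(\det g_3)^3P_2(x)$ and value $1$ at $B=p_1\otimes(-E_{11}+E_{22})+p_2\otimes E_{12}+p_3\otimes E_{21}$; explicitly, if $\det(u_1B_1+u_2B_2+u_3B_3)=au_1^2+bu_1u_2+cu_1u_3+du_2^2+eu_2u_3+fu_3^2$ then $P_2=4adf+bce-ae^2-dc^2-fb^2$. *)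

(* Defs.v *)
From HB Require Import structures.
From mathcomp Require Import all_boot all_order all_algebra all_field.
From mathcomp Require Import mpoly.

Set Implicit Arguments.
Unset Strict Implicit.
Unset Printing Implicit Defensive.

Import GRing.Theory.
Local Open Scope ring_scope.

(* The relation R, restricted to A, is the graph (on representatives) of a    *)
(* bijection from A modulo eX onto B modulo eY.                               *)
Definition induces_quotient_bijection (X Y : Type)
    (A : X -> Prop) (eX : X -> X -> Prop)
    (B : Y -> Prop) (eY : Y -> Y -> Prop) (R : X -> Y -> Prop) : Prop :=
  [/\ forall x, A x -> exists y, R x y,
      forall x y, A x -> R x y -> B y,
      forall x x' y y', A x -> A x' -> R x y -> R x' y' ->
        (eX x x' <-> eY y y')
    & forall y, B y -> exists x, A x /\ exists y', R x y' /\ eY y' y].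

Section Spaces.
Variable k : fieldType.

(* wedge^2 A^3 is coordinatized by the basis                                  *)
(*   e_i = p_(i+1) /\ p_(i+2)   (indices in Z/3),                             *)
(* i.e. p_2 /\ p_3, p_3 /\ p_1, p_1 /\ p_2 in 1-based numbering.              *)
Definition wedge (v w : 'cV[k]_3) : 'cV[k]_3 :=
  \col_i (v (i + 1) 0 * w (i + 2) 0 - v (i + 2) 0 * w (i + 1) 0).

(* The pairing wedge^2 A^3 * A^3 -> wedge^3 A^3 = A^1 for which               *)
(* p_1 /\ p_2 /\ p_3 = 1: in the above basis, e_i /\ p_j = (i == j)%:R.       *)
Definition wedge21 (a v : 'cV[k]_3) : k := \sum_i a i 0 * v i 0.

(* The matrix of wedge^2 g, which maps e_j to (g p_(j+1)) /\ (g p_(j+2)).     *)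
Definition wedge2_mx (g : 'M[k]_3) : 'M[k]_3 :=
  \matrix_(i, j) wedge (col (j + 1) g) (col (j + 2) g) i 0.

(* A^n (x) M_2: the family M stands for \sum_i p_i (x) M i. For n = 2 this is  *)
(* k^2 (x) k^2 (x) k^2, a (x) b (x) c being the family i |-> a_i (b *m c^T).   *)
Definition tensM (n : nat) : Type := {ffun 'I_n -> 'M[k]_2}.

Definition tensM_act n (h : 'M[k]_n) (g g' : 'M[k]_2) (M : tensM n) : tensM n :=
  [ffun i => \sum_j h i j *: (g *m M j *m g'^T)].

(* V = wedge^2 A^3 (x) A^2 (+) A^3 (x) M_2; the (i, j) entry of the first     *)
(* component is the coefficient of e_i (x) p_j.                               *)
Definition V : Type := ('M[k]_(3, 2) * tensM 3)%type.

Definition V_act (g1 : 'M[k]_3) (g2 g3 g4 : 'M[k]_2) (x : V) : V :=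
  (wedge2_mx g1 *m x.1 *m g4^T, tensM_act g1 g2 g3 x.2).

Definition same_G_orbit (x y : V) : Prop :=
  exists (g1 : 'M[k]_3) (g2 g3 g4 : 'M[k]_2),
    [/\ g1 \in unitmx, g2 \in unitmx, g3 \in unitmx, g4 \in unitmx
      & y = V_act g1 g2 g3 g4 x].

Definition same_GL2cube_orbit (M N : tensM 2) : Prop :=
  exists h g g' : 'M[k]_2,
    [/\ h \in unitmx, g \in unitmx, g' \in unitmx & N = tensM_act h g g' M].

Definition Phi (x : V) : tensM 2 :=
  [ffun j => \sum_l wedge21 (col j x.1) (delta_mx l 0) *: x.2 l].

(* The form \det (\sum_i u_i M_i) in the indeterminates u_i.                  *)
Definition det_form n (M : tensM n) : {mpoly k[n]} :=
  \det (\sum_i 'X_i *: map_mx (@mpolyC n k) (M i)).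

Definition qcoef n (F : {mpoly k[n]}) (i j : 'I_n) : k :=
  F@_(U_(i) + U_(j))%MM.

Definition disc2 (F : {mpoly k[2]}) : k :=
  qcoef F 0 1 ^+ 2 - 4 * qcoef F 0 0 * qcoef F 1 1.

Definition semistable (M : tensM 2) : Prop := disc2 (det_form M) != 0.

Definition P1 (x : V) : k := disc2 (det_form (Phi x)).

Definition P2 (x : V) : k :=
  let Q := det_form x.2 in
  let a := qcoef Q 0 0 in let b := qcoef Q 0 1 in let c := qcoef Q 0 2 in
  let d := qcoef Q 1 1 in let e := qcoef Q 1 2 in let f := qcoef Q 2 2 in
  4 * a * d * f + b * c * e - a * e ^+ 2 - d * c ^+ 2 - f * b ^+ 2.

Definition U (x : V) : Prop := P1 x != 0 /\ P2 x != 0.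

Definition Ex2 (L : fieldExtType k) : Prop :=
  separable 1 {:L} /\ (\dim {:L} <= 2)%N.

Definition k_isomorphic (L L' : fieldExtType k) : Prop :=
  exists f : {lrmorphism L -> L'}, bijective f.

(* L is generated over k by the roots of the non-zero binary form F: over L,  *)
(* F is a product of two linear forms, with zeros (s i : t i) in P^1(L), and  *)
(* these points generate L. A point (s : t) is defined over k(s / t), which   *)
(* is k for the point at infinity t = 0, as it should be, since s / 0 = 0.    *)
Definition root_field (F : {mpoly k[2]}) (L : fieldExtType k) : Prop :=
  exists s t : 'I_2 -> L,
    map_mpoly (in_alg L) F = \prod_i (t i *: 'X_0 - s i *: 'X_1)
    /\ <<1 & [seq s i / t i | i : 'I_2]>>%VS = {:L}%VS.

End Spaces.

(* Main.v *)
From HB Require Import structures.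
From Stdlib Require Import Classical.
Require Import Defs.
From mathcomp Require Import all_boot all_order all_algebra all_field.
From mathcomp Require Import mpoly ring.

(* Every semistable pair is equivalent to some (1, T) with T the companion     *)
(* matrix of a separable monic quadratic polynomial p; the root field is then  *)
(* k[X]/(p) or k, according to whether p is irreducible. If two such           *)
(* polynomials have the same root field, a root of one is a + b r with r a     *)
(* root of the other and a, b in k, and the pairs (1, T), (1, a + b T) are     *)
(* equivalent.                                                                 *)
(*                                                                             *)
(* P_2(x) is the determinant of a matrix C with tr(B_i C) = 0 for i = 1, 2, 3. *)
(* If it is non-zero, replacing B_i by B_i C moves the span of the B_i to sl_2 *)
(* and B to the fixed basis w of sl_2; on such points Phi is a bijection onto  *)
(* pairs of traceless matrices. If the traceless pairs M and N = (g M_i g'^T)  *)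
(* are equivalent and semistable, then tr(M_i X) = 0 for X = g'^T g, which     *)
(* forces X to lie in the span of 1 and M_1 M_2. Right multiplication by X     *)
(* then preserves the span of M_1 and M_2, and N is obtained from M by h in    *)
(* GL_2 and conjugation by g, which stabilizes w up to GL_3.                   *)

Set Implicit Arguments.
Unset Strict Implicit.
Unset Printing Implicit Defensive.

Import GRing.Theory.
Local Open Scope ring_scope.

(** * The determinant form *)

(** Everything is reduced to normal forms. For the second bijection, [orbit_monic_tens] brings a
    semistable pair to [monic_tens t n], with form x^2 - t x y + n y^2, and [root_field_monic]
    identifies its root field as one generated by r with r (t - r) = n. Isomorphic root fields have
    affinely related generators ([quad_gen_affine]), and affine changes come from the group
    ([monic_tens_affine]). [Ex2_quad_gen] reaches every field of Ex_2. For the first, [Phi_act]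
    gives equivariance and [P2_normal_form] turns the second component into [sl2_basis]; the first
    component then lists the coordinates of the two traceless matrices of [Phi x]. Thus G-orbits in
    U become orbits of traceless pairs under GL_2 and conjugation, and [Phi_fibre] shows that GL_2^3
    identifies no more semistable traceless pairs than these do. Surjectivity holds because every
    semistable pair is equivalent to a traceless one. *)

Lemma mnm1D_eq n (i j p q : 'I_n) :
  ((U_(i) + U_(j))%MM == (U_(p) + U_(q))%MM)
  = (i == p) && (j == q) || (i == q) && (j == p).
Proof.
apply/eqP/idP => [/mnmP e|/orP[]/andP[/eqP-> /eqP->] //]; last first.
  by rewrite addmC.
move: (e i) (e j) (e p) (e q); rewrite !mnmDE !mnm1E !eqxx.
rewrite (eq_sym j i) (eq_sym p i) (eq_sym q i) (eq_sym p j) (eq_sym q j) (eq_sym q p).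
by do ![case: eqP => //=].
Qed.

Lemma big_I2 (R : nmodType) (F : 'I_2 -> R) : \sum_i F i = F 0 + F 1.
Proof.
rewrite !big_ord_recl big_ord0 addr0.
by congr (F _ + F _); apply: val_inj.
Qed.

Lemma big_I3 (R : nmodType) (F : 'I_3 -> R) : \sum_i F i = F 0 + F 1 + F 2.
Proof.
rewrite !big_ord_recl big_ord0 addr0 addrA.
by congr (F _ + F _ + F _); apply: val_inj.
Qed.

Lemma I2_ind (P : 'I_2 -> Prop) : P 0 -> P 1 -> forall i, P i.
Proof.
move=> P0 P1 [[|[|//]] lti]; [have := P0 | have := P1]; congr P; exact: val_inj.
Qed.

Lemma I3_ind (P : 'I_3 -> Prop) : P 0 -> P 1 -> P 2 -> forall i, P i.
Proof.
move=> P0 P1 P2 [[|[|[|//]]] lti]; [have := P0 | have := P1 | have := P2];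
  congr P; exact: val_inj.
Qed.

Lemma det_mx22 (R : comNzRingType) (A : 'M[R]_2) :
  \det A = A 0 0 * A 1 1 - A 0 1 * A 1 0.
Proof.
rewrite (expand_det_row _ 0) big_I2 /cofactor !det_mx11 !mxE /= expr0 expr1.
rewrite mul1r mulN1r mulrN.
by congr (_ * A _ _ - _ * A _ _); apply: val_inj.
Qed.

Section S.
Variable k : fieldType.
(** An asymmetric bilinear form equal to [\det] on the diagonal; its symmetrization is the polar
    form of [\det], so characteristic 2 is covered. *)
Definition bdet (A B : 'M[k]_2) : k := A 0 0 * B 1 1 - A 0 1 * B 1 0.

Lemma det_formE n (M : tensM k n) :
  det_form M = \sum_i \sum_j bdet (M i) (M j) *: 'X_[U_(i) + U_(j)].
Proof.
rewrite /det_form det_mx22 !summxE !mulr_suml.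
under eq_bigr do rewrite mulr_sumr.
under [X in _ - X]eq_bigr do rewrite mulr_sumr.
rewrite -sumrB; apply: eq_bigr => i _; rewrite -sumrB; apply: eq_bigr => j _.
rewrite !mxE -mul_mpolyC /bdet mpolyCB !mpolyCM mpolyXD.
by ring.
Qed.

Lemma qcoef_det_form n (M : tensM k n) i j :
  qcoef (det_form M) i j =
  if i == j then \det (M i) else bdet (M i) (M j) + bdet (M j) (M i).
Proof.
rewrite /qcoef det_formE raddf_sum /=.
under eq_bigr => p _.
  rewrite raddf_sum /=.
  under eq_bigr do rewrite mcoeffZ mcoeffX mnm1D_eq.
  over.
have [<-|nij] := eqVneq i j.
  rewrite (bigD1 i) //= (bigD1 i) //= eqxx mulr1 det_mx22.
  rewrite big1 ?addr0 => [|q nq]; last by rewrite (negPf nq) andbF mulr0.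
  rewrite big1 ?addr0 // => p np; rewrite big1 // => q _.
  by rewrite (negPf np) mulr0.
have nji: j != i by rewrite eq_sym.
rewrite (bigD1 i) //= [X in _ + X](bigD1 j) //= addrA [X in _ + X]big1 ?addr0.
  congr (_ + _).
    rewrite (bigD1 j) //= !eqxx mulr1 big1 ?addr0 // => q /negPf nq.
    by rewrite nq (negPf nij) mulr0.
  rewrite (bigD1 i) //= !eqxx orbT mulr1 big1 ?addr0 // => q /negPf nq.
  by rewrite nq (negPf nji) mulr0.
move=> p /andP[/negPf np /negPf np']; rewrite big1 // => q _.
by rewrite np np' mulr0.
Qed.
End S.

(** * Orbits of GL_2^3 *)

Section TensM.
Variable k : fieldType.

Definition polar (A B : 'M[k]_2) : k := bdet A B + bdet B A.

Lemma polarE A B : polar A B = \det (A + B) - \det A - \det B.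
Proof. by rewrite !det_mx22 !mxE /polar /bdet; ring. Qed.

Lemma polar_mul (g g' A B : 'M[k]_2) :
  polar (g *m A *m g') (g *m B *m g') = \det g * \det g' * polar A B.
Proof. by rewrite !polarE -mulmxDl -mulmxDr !det_mulmx; ring. Qed.

Lemma det_comb2 a b (A B : 'M[k]_2) :
  \det (a *: A + b *: B) =
  a ^+ 2 * \det A + a * b * polar A B + b ^+ 2 * \det B.
Proof. by rewrite !det_mx22 !mxE /polar /bdet; ring. Qed.

Lemma polar_comb2 a b c d (A B : 'M[k]_2) :
  polar (a *: A + b *: B) (c *: A + d *: B) =
  2 * a * c * \det A + (a * d + b * c) * polar A B + 2 * b * d * \det B.
Proof. by rewrite !det_mx22 /polar /bdet !mxE; ring. Qed.

Lemma disc2_det_form (M : tensM k 2) :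
  disc2 (det_form M) = polar (M 0) (M 1) ^+ 2 - 4 * \det (M 0) * \det (M 1).
Proof. by rewrite /disc2 !qcoef_det_form. Qed.

Lemma tensM_actE n (h : 'M[k]_n) g g' (M : tensM k n) i :
  tensM_act h g g' M i = g *m (\sum_j h i j *: M j) *m g'^T.
Proof.
rewrite ffunE mulmx_sumr mulmx_suml; apply: eq_bigr => j _.
by rewrite -scalemxAr -scalemxAl.
Qed.

Lemma tensM_act1l n g g' (M : tensM k n) i :
  tensM_act 1%:M g g' M i = g *m M i *m g'^T.
Proof.
rewrite tensM_actE (bigD1 i) //= big1 ?addr0 ?mxE ?eqxx ?scale1r // => j nj.
by rewrite mxE eq_sym (negPf nj) scale0r.
Qed.

Lemma tensM_actA n (h h' : 'M[k]_n) g1 g2 g1' g2' (M : tensM k n) :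
  tensM_act h g1 g2 (tensM_act h' g1' g2' M) =
  tensM_act (h *m h') (g1 *m g1') (g2 *m g2') M.
Proof.
apply/ffunP => i; rewrite !ffunE.
under eq_bigr => j _.
  rewrite ffunE mulmx_sumr mulmx_suml scaler_sumr.
  under eq_bigr do rewrite -scalemxAr -scalemxAl scalerA.
  over.
rewrite exchange_big /=; apply: eq_bigr => j _.
by rewrite mxE scaler_suml trmx_mul !mulmxA.
Qed.

Lemma tensM_act1 n (M : tensM k n) : tensM_act 1%:M 1%:M 1%:M M = M.
Proof.
by apply/ffunP => i; rewrite tensM_act1l trmx1 mul1mx mulmx1.
Qed.

Lemma same_GL2cube_orbit_sym (M N : tensM k 2) :
  same_GL2cube_orbit M N -> same_GL2cube_orbit N M.
Proof.
move=> [h [g [g' [uh ug ug' ->]]]].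
exists (invmx h), (invmx g), (invmx g'); rewrite !unitmx_inv.
by split=> //; rewrite tensM_actA !mulVmx // tensM_act1.
Qed.

Lemma same_GL2cube_orbit_trans (M N P : tensM k 2) :
  same_GL2cube_orbit M N -> same_GL2cube_orbit N P -> same_GL2cube_orbit M P.
Proof.
move=> [h [g [g' [uh ug ug' ->]]]] [h1 [g1 [g1' [uh1 ug1 ug1' ->]]]].
exists (h1 *m h), (g1 *m g), (g1' *m g'); rewrite !unitmx_mul.
by rewrite uh ug ug' uh1 ug1 ug1' tensM_actA.
Qed.

(** [g] and [g'] scale the form F by their determinants, while [h] acts by a linear substitution,
    which multiplies the discriminant by [\det h ^+ 2]. *)
Lemma disc2_act h g g' (M : tensM k 2) :
  disc2 (det_form (tensM_act h g g' M)) =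
  (\det h * \det g * \det g') ^+ 2 * disc2 (det_form M).
Proof.
set N := tensM_act 1%:M g g' M.
have -> : tensM_act h g g' M = tensM_act h 1%:M 1%:M N.
  by rewrite tensM_actA mulmx1 !mul1mx.
rewrite !disc2_det_form !ffunE !big_I2 !mul1mx !trmx1 !mulmx1.
rewrite polar_comb2 !det_comb2 !tensM_act1l polar_mul !det_mulmx det_tr (det_mx22 h).
by move: (polar _ _) (\det (M 0)) (\det (M 1)) => b a c; ring.
Qed.
End TensM.

(** * Companion normal form of a semistable pair *)

Section NormalForm.
Variable k : fieldType.

Definition mx22 (a b c d : k) : 'M[k]_2 :=
  \matrix_(i, j) (if i == 0 then if j == 0 then a else b
                  else if j == 0 then c else d).

Lemma mx22P (A B : 'M[k]_2) :
  A 0 0 = B 0 0 -> A 0 1 = B 0 1 -> A 1 0 = B 1 0 -> A 1 1 = B 1 1 -> A = B.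
Proof.
move=> e00 e01 e10 e11; apply/matrixP.
by elim/I2_ind; elim/I2_ind.
Qed.

Lemma det_mx22E a b c d : \det (mx22 a b c d) = a * d - b * c.
Proof. by rewrite det_mx22 !mxE. Qed.

Lemma unitmx22 a b c d : (mx22 a b c d \in unitmx) = (a * d - b * c != 0).
Proof. by rewrite unitmxE det_mx22E unitfE. Qed.

Definition companion2 (t n : k) : 'M[k]_2 := mx22 0 (- n) 1 t.

Definition tens2 (A B : 'M[k]_2) : tensM k 2 :=
  [ffun i => if i == 0 then A else B].

Lemma tens2P (M N : tensM k 2) : M 0 = N 0 -> M 1 = N 1 -> M = N.
Proof. by move=> e0 e1; apply/ffunP; elim/I2_ind. Qed.

Lemma tensM_act2 (h g g' : 'M[k]_2) (M : tensM k 2) :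
  tensM_act h g g' M = tens2 (g *m (h 0 0 *: M 0 + h 0 1 *: M 1) *m g'^T)
                             (g *m (h 1 0 *: M 0 + h 1 1 *: M 1) *m g'^T).
Proof. by apply: tens2P; rewrite tensM_actE big_I2 ffunE. Qed.

Lemma tens2_0 A B : tens2 A B 0 = A. Proof. by rewrite ffunE. Qed.
Lemma tens2_1 A B : tens2 A B 1 = B. Proof. by rewrite ffunE. Qed.

(** A non-zero discriminant excludes scalar T, so one of e_1, e_2, e_1 + e_2 is not an eigenvector;
    call it v. By Cayley-Hamilton, T is a companion matrix in the basis v, T v. *)
Lemma companion2_conj (T : 'M[k]_2) : \tr T ^+ 2 - 4 * \det T != 0 ->
  exists2 P, P \in unitmx & T *m P = P *m companion2 (\tr T) (\det T).
Proof.
have -> : \tr T = T 0 0 + T 1 1 by rewrite /mxtrace big_I2.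
rewrite det_mx22 => dT.
(* [P] has columns v, T v *)
have H x y : let P := mx22 x (T 0 0 * x + T 0 1 * y)
                           y (T 1 0 * x + T 1 1 * y) in
    T *m P = P *m companion2 (T 0 0 + T 1 1) (T 0 0 * T 1 1 - T 0 1 * T 1 0).
  by apply: mx22P; rewrite !mxE !big_I2 !mxE /=; ring.
have [c0|c0] := eqVneq (T 1 0) 0; last first.
  exists (mx22 1 (T 0 0 * 1 + T 0 1 * 0) 0 (T 1 0 * 1 + T 1 1 * 0)) => //.
  by rewrite unitmx22 !mulr0 !mulr1 !addr0 mul1r subr0.
have [b0|b0] := eqVneq (T 0 1) 0; last first.
  exists (mx22 0 (T 0 0 * 0 + T 0 1 * 1) 1 (T 1 0 * 0 + T 1 1 * 1)) => //.
  by rewrite unitmx22 !mulr0 !mulr1 !add0r mul0r sub0r oppr_eq0.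
exists (mx22 1 (T 0 0 * 1 + T 0 1 * 1) 1 (T 1 0 * 1 + T 1 1 * 1)) => //.
rewrite unitmx22; apply: contraNneq dT; rewrite b0 c0 !mulr1 mul1r addr0 add0r => e.
rewrite [X in X == 0](_ : _ = (T 1 1 - T 0 0) ^+ 2); last by ring.
by rewrite e expr0n.
Qed.

(** The pencil contains an invertible A: a form F vanishing at (1, 0) and (0, 1) is a non-zero
    multiple of u_0 u_1, hence non-zero at (1, 1). Multiplication by A^-1 makes the first matrix 1,
    and conjugation treats the second. *)
Lemma semistable_normal_form (M : tensM k 2) : semistable M ->
  exists t n, same_GL2cube_orbit M (tens2 1%:M (companion2 t n)).
Proof.
move=> ssM.
have [h uh dh] : exists2 h : 'M[k]_2, h \in unitmx
    & \det (h 0 0 *: M 0 + h 0 1 *: M 1) != 0.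
  have [d0|d0] := eqVneq (\det (M 0)) 0; last first.
    by exists 1%:M; rewrite ?unitmx1 // !mxE scale1r scale0r addr0.
  have [d1|d1] := eqVneq (\det (M 1)) 0; last first.
    exists (mx22 0 1 1 0); first by rewrite unitmx22 mulr0 mulr1 sub0r oppr_eq0 oner_eq0.
    by rewrite !mxE /= scale1r scale0r add0r.
  exists (mx22 1 1 0 1); first by rewrite unitmx22 mulr0 mulr1 subr0 oner_eq0.
  move: ssM; rewrite /semistable disc2_det_form d0 d1 mulr0 subr0 expf_eq0 /=.
  by rewrite !mxE /= det_comb2 d0 d1 !mulr0 add0r addr0 !mul1r.
set A := _ + _ in dh; set B := h 1 0 *: M 0 + h 1 1 *: M 1.
have uA : A \in unitmx by rewrite unitmxE unitfE.
set T := invmx A *m B.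
have hM g g' :
    tensM_act h (g *m invmx A) g' M = tens2 (g *m g'^T) (g *m T *m g'^T).
  by rewrite tensM_act2 -!(mulmxA g (invmx A)) mulVmx // mulmx1.
have disc_neq0 : \tr T ^+ 2 - 4 * \det T != 0.
  have -> : \tr T = polar (1%:M) T.
    by rewrite /mxtrace big_I2 /polar /bdet !mxE /=; ring.
  have := disc2_act h (1%:M *m invmx A) 1%:M M.
  rewrite hM trmx1 !mulmx1 !mul1mx disc2_det_form tens2_0 tens2_1 det1 mulr1.
  move->; rewrite mulf_neq0 // expf_neq0 // !mulf_neq0 ?det1 ?oner_neq0 //.
    by rewrite -unitfE -unitmxE.
  by rewrite -unitfE -unitmxE unitmx_inv.
have [P uP TP] := companion2_conj disc_neq0.
exists (\tr T), (\det T), h, (invmx P *m invmx A), P^T.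
rewrite unitmx_mul !unitmx_inv unitmx_tr; split=> //; first by rewrite uP uA.
by rewrite hM trmxK -mulmxA TP !mulmxA mulVmx // mul1mx.
Qed.
End NormalForm.

(** * Root fields *)

Section RootField.
Variable k : fieldType.

Lemma det_form2E (M : tensM k 2) :
  det_form M = \det (M 0) *: 'X_[U_(0%R) + U_(0%R)]
    + polar (M 0) (M 1) *: 'X_[U_(0%R) + U_(1%R)] + \det (M 1) *: 'X_[U_(1%R) + U_(1%R)].
Proof.
have detE A : \det A = bdet A A by rewrite det_mx22.
rewrite det_formE big_I2 !big_I2 !detE (addmC U_(1%R)%MM U_(0%R)%MM).
by rewrite [polar _ _ *: _]scalerDl !addrA.
Qed.

Lemma prod_linear_forms (R : comNzRingType) (s t : 'I_2 -> R) :
  \prod_i (t i *: 'X_0 - s i *: 'X_1) =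
  (t 0 * t 1) *: 'X_[U_(0%R) + U_(0%R)] - (t 0 * s 1 + s 0 * t 1) *: 'X_[U_(0%R) + U_(1%R)]
    + (s 0 * s 1) *: 'X_[U_(1%R) + U_(1%R)] :> {mpoly R[2]}.
Proof.
rewrite !big_ord_recl big_ord0 mulr1 (_ : lift ord0 ord0 = 1); last exact: val_inj.
by rewrite -!mul_mpolyC !mpolyXD !mpolyCD !mpolyCM; ring.
Qed.

Lemma root_fieldP (M : tensM k 2) (L : fieldExtType k) :
  root_field (det_form M) L <->
  exists s t : 'I_2 -> L,
    [/\ (\det (M 0))%:A = t 0 * t 1,
        (polar (M 0) (M 1))%:A = - (t 0 * s 1 + s 0 * t 1),
        (\det (M 1))%:A = s 0 * s 1
      & <<1 & [:: s 0%R / t 0%R; s 1%R / t 1%R]>>%VS = {:L}%VS].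
Proof.
have gE (s t : 'I_2 -> L) : [seq s i / t i | i : 'I_2] = [:: s 0 / t 0; s 1 / t 1].
  rewrite /image_mem enum_ordSl enum_ordSl /=.
  rewrite (_ : lift ord0 ord0 = 1); last exact: val_inj.
  by rewrite (size0nil (size_enum_ord 0)).
split=> -[s [t]]; last first.
  move=> [e0 e1 e2 gen]; exists s, t; split; last by rewrite gE.
  rewrite det_form2E prod_linear_forms !rmorphD /= !map_mpolyZ !map_mpolyX /=.
  by rewrite e0 e1 e2 scaleNr.
rewrite gE => -[/mpolyP e gen]; exists s, t; split=> //.
- have := e (U_(0%R) + U_(0%R))%MM; rewrite prod_linear_forms det_form2E.
  rewrite mcoeff_map_mpoly !mcoeffD !mcoeffN !mcoeffZ !mcoeffX !mnm1D_eq /=.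
  by rewrite !mulr0 !mulr1 oppr0 !addr0.
- have := e (U_(0%R) + U_(1%R))%MM; rewrite prod_linear_forms det_form2E.
  rewrite mcoeff_map_mpoly !mcoeffD !mcoeffN !mcoeffZ !mcoeffX !mnm1D_eq /=.
  by rewrite !mulr0 !mulr1 !addr0 !add0r.
have := e (U_(1%R) + U_(1%R))%MM; rewrite prod_linear_forms det_form2E.
rewrite mcoeff_map_mpoly !mcoeffD !mcoeffN !mcoeffZ !mcoeffX !mnm1D_eq /=.
by rewrite !mulr0 !mulr1 oppr0 !add0r.
Qed.

(** Homographies over k preserve the K-points of P^1. As x / 0 = 0, the point at infinity and zero
    denominators also give values in K. *)
Lemma homography_mem (L : fieldExtType k) (K : {subfield L}) (s t : L) a b c d :
  s / t \in K -> (a *: s + b *: t) / (c *: s + d *: t) \in K.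
Proof.
have [-> _|t0 sK] := eqVneq t 0.
  rewrite !scaler0 !addr0; have [->|s0] := eqVneq s 0.
    by rewrite !scaler0 mul0r mem0v.
  rewrite -[a *: s]mulr_algl -[c *: s]mulr_algl -mulf_div divff // mulr1.
  by rewrite rpred_div // rpredZ // rpred1.
have e x y : x *: s + y *: t = (x *: (s / t) + y%:A) * t.
  by rewrite mulrDl -scalerAl divfK // mulr_algl.
rewrite !e -mulf_div divff // mulr1.
by rewrite rpred_div // rpredD ?rpredZ ?rpred1.
Qed.

Lemma scale_algE (L : fieldExtType k) (a : k) (x : L) : a *: x = in_alg L a * x.
Proof. by rewrite mulr_algl. Qed.

Lemma alg_add (L : fieldExtType k) (x y : k) : (x + y)%:A = x%:A + y%:A :> L.
Proof. exact: scalerDl. Qed.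

Lemma alg_sub (L : fieldExtType k) (x y : k) : (x - y)%:A = x%:A - y%:A :> L.
Proof. exact: scalerBl. Qed.

Lemma alg_mul (L : fieldExtType k) (x y : k) : (x * y)%:A = x%:A * y%:A :> L.
Proof. by rewrite mulr_algl scalerA. Qed.

Lemma root_field_orbit (M N : tensM k 2) (L : fieldExtType k) :
  same_GL2cube_orbit M N -> root_field (det_form M) L -> root_field (det_form N) L.
Proof.
move=> [h [g [g' [uh ug ug' ->]]]] /root_fieldP[s [t [e0 e1 e2 gen]]].
(* The first linear factor absorbs the scalar by which [g] and [g'] multiply F. *)
pose l i := if i == 0 :> 'I_2 then (\det g * \det g')%:A : L else 1.
have l0 i : l i != 0.
  rewrite /l; case: ifP; rewrite ?oner_neq0 // -in_algE fmorph_eq0 mulf_neq0 //.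
    by rewrite -unitfE -unitmxE.
  by rewrite -unitfE -unitmxE.
(* Coefficients of the factor t X_0 - s X_1 after substituting the transpose of [h]. *)
pose s' i := h 1 1 *: s i - h 1 0 *: t i.
pose t' i := h 0 0 *: t i - h 0 1 *: s i.
apply/root_fieldP; exists (fun i => l i * s' i), (fun i => l i * t' i).
rewrite /= -!mulf_div !divff // !mul1r.
rewrite tensM_act2 tens2_0 tens2_1 polar_mul !det_mulmx det_tr !det_comb2 polar_comb2.
move: (\det (M 0)) (polar _ _) (\det (M 1)) e0 e1 e2 => a b c e0 e1 e2.
rewrite /s' /t' /l /= -![in _ *: s _]mulr_algl -![in _ *: t _]mulr_algl.
split.
- rewrite !(expr2, alg_mul, alg_add, scaler_nat, e0, e1, e2); ring.
- rewrite !(expr2, alg_mul, alg_add, scaler_nat, e0, e1, e2); ring.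
- rewrite !(expr2, alg_mul, alg_add, scaler_nat, e0, e1, e2); ring.
rewrite !mulr_algl -/(s' 0) -/(s' 1) -/(t' 0) -/(t' 1).
apply/eqP; rewrite eqEsubv subvf -gen /=.
apply/Fadjoin_seqP; split; first exact: sub1v.
have d0 : \det h != 0 by rewrite -unitfE -unitmxE.
have sE i : s i = (\det h)^-1 *: (h 0 0 *: s' i + h 1 0 *: t' i).
  apply: (canRL (scalerK d0)); rewrite det_mx22 /s' /t'.
  by rewrite !scale_algE; ring.
have tE i : t i = (\det h)^-1 *: (h 0 1 *: s' i + h 1 1 *: t' i).
  apply: (canRL (scalerK d0)); rewrite det_mx22 /s' /t'.
  by rewrite !scale_algE; ring.
have mem (K : {subfield L}) i : s' i / t' i \in K -> s i / t i \in K.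
  by move: (s' i) (t' i) (sE i) (tE i) => x y -> ->; rewrite !scalerDr !scalerA; apply: homography_mem.
move=> _ /[!inE] /orP[]/eqP->; apply: (mem <<1 & _>>%AS);
  by apply: seqv_sub_adjoin; rewrite !inE eqxx ?orbT.
Qed.
End RootField.

(** * Quadratic extensions *)

Section FactorThroughSurjection.
Variables (F : fieldType) (A : algType F) (L L' : fieldExtType F).
Variables (phi : {lrmorphism A -> L}) (psi : {lrmorphism A -> L'}).
Hypothesis phi_surj : forall x, exists q, phi q == x.
Hypothesis ker_sub : forall q, phi q = 0 -> psi q = 0.

(** Two preimages of x differ by an element of the kernel of [phi], so [ker_sub] makes the value
    independent of the choice. *)
Definition lift_hom (x : L) : L' := psi (xchoose (phi_surj x)).

Let lift_homE q : lift_hom (phi q) = psi q.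
Proof.
apply/eqP; rewrite -subr_eq0 -raddfB; apply/eqP/ker_sub.
rewrite raddfB; apply/eqP; rewrite subr_eq0.
exact: (xchooseP (phi_surj (phi q))).
Qed.

Let lift_hom_monoid : monoid_morphism lift_hom.
Proof.
split=> [|x y]; first by rewrite -(rmorph1 phi) lift_homE rmorph1.
have [[p /eqP<-] [q /eqP<-]] := (phi_surj x, phi_surj y).
by rewrite -rmorphM !lift_homE rmorphM.
Qed.

Let lift_hom_linear : linear lift_hom.
Proof.
move=> a x y; have [[p /eqP<-] [q /eqP<-]] := (phi_surj x, phi_surj y).
by rewrite -linearP !lift_homE linearP.
Qed.

HB.instance Definition _ := GRing.isLinear.Build F L L' *:%R lift_hom lift_hom_linear.
HB.instance Definition _ := GRing.isMonoidMorphism.Build L L' lift_hom lift_hom_monoid.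

Lemma lrmorphism_factor : inhabited {lrmorphism L -> L'}.
Proof. exact: (inhabits (lift_hom : {lrmorphism L -> L'})). Qed.
End FactorThroughSurjection.

(** Field homomorphisms are injective, so the two dimensions agree and f is onto. *)
Lemma k_isomorphic_of_homs (k : fieldType) (L L' : fieldExtType k)
  (f : {lrmorphism L -> L'}) (g : {lrmorphism L' -> L}) : k_isomorphic L L'.
Proof.
exists f; pose fl := linfun f; pose gl := linfun g.
have kf : lker fl == 0%VS by apply/lker0P => x y; rewrite !lfunE; exact: fmorph_inj.
have kg : lker gl == 0%VS by apply/lker0P => x y; rewrite !lfunE; exact: fmorph_inj.
have df : \dim (limg fl) = \dim {:L} by rewrite limg_dim_eq // (eqP kf) capv0.
have dg : \dim (limg gl) = \dim {:L'} by rewrite limg_dim_eq // (eqP kg) capv0.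
have sf : limg fl = fullv.
  by apply/eqP; rewrite eqEdim subvf df -dg dimvS ?subvf.
exists (fl^-1)%VF => x; first by rewrite -[f x]lfunE lker0_lfunK.
by rewrite -[f _]lfunE limg_lfunVK // sf memvf.
Qed.

Section QuadraticGenerator.
Variables (k : fieldType) (t n : k).

(** r is a root of X^2 - t X + n generating L. It may lie in k, so the split case L = k is
    included. *)
Definition quad_gen (L : fieldExtType k) (r : L) :=
  r * (t%:A - r) = n%:A /\ <<1; r>>%VS = {:L}%VS.

(** a + b X is the remainder of q modulo X^2 - t X + n; it serves all L and r at once, which allows
    evaluations in two fields to be compared. *)
Lemma horner_quad (q : {poly k}) : exists a b : k,
  forall (L : fieldExtType k) (r : L), r * (t%:A - r) = n%:A ->
    fieldExt_horner r q = a%:A + b *: r.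
Proof.
elim/poly_ind: q => [|q c [a [b IH]]].
  by exists 0, 0 => L r _; rewrite rmorph0 !scale0r addr0.
exists (c - b * n), (a + b * t) => L r e.
rewrite rmorphD rmorphM /= fieldExt_hornerC fieldExt_hornerX (IH L r e).
rewrite !scale_algE ?mulr1 !in_algE alg_sub alg_add !alg_mul -e.
by ring.
Qed.
End QuadraticGenerator.

Section QuadraticFields.
Variable k : fieldType.
Implicit Types (L : fieldExtType k) (t n : k) (M : tensM k 2).

Lemma quad_gen_surj t n L (r : L) : quad_gen t n r ->
  forall x, exists q : {poly k}, fieldExt_horner r q == x.
Proof.
move=> [_ gen] x; have /Fadjoin1_polyP[q ->] : x \in <<1; r>>%VS by rewrite gen memvf.
by exists q.
Qed.

Lemma quad_gen_span t n L (r : L) : quad_gen t n r ->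
  forall x, exists a b : k, x = a%:A + b *: r.
Proof.
move=> gen x; have [q /eqP<-] := quad_gen_surj gen x.
by have [a [b e]] := horner_quad t n q; exists a, b; rewrite e //; case: gen.
Qed.

Lemma alg_indep L (r : L) (a b : k) : r \notin 1%VS ->
  a%:A + b *: r = 0 -> a = 0 /\ b = 0.
Proof.
move=> r1 e; have b0 : b = 0.
  apply: contraNeq r1 => b0; apply/vlineP; exists (- (b^-1 * a)).
  apply: (scalerI b0); rewrite scalerA mulrN mulrA divff // mul1r scaleNr.
  by apply/eqP; rewrite -addr_eq0 addrC e.
move: e; rewrite b0 scale0r addr0 => /eqP.
by rewrite scaler_eq0 oner_eq0 orbF => /eqP->.
Qed.

Lemma quad_gen_hom t n L L' (r : L) (r' : L') :
  quad_gen t n r -> r' * (t%:A - r') = n%:A -> inhabited {lrmorphism L -> L'}.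
Proof.
move=> gen e'.
have [r1|r1] := boolP (r \in 1%VS); last first.
  apply: (@lrmorphism_factor _ _ _ _ (fieldExt_horner r) (fieldExt_horner r')).
    exact: quad_gen_surj gen.
  move=> q /=; have [a [b e]] := horner_quad t n q; rewrite (e _ _ e') (e _ r); last by case: gen.
  by move=> /(alg_indep r1)[-> ->]; rewrite !scale0r addr0.
have [a ra] := vlineP _ _ r1.
(* Here L = k. Evaluation at a itself is used, since r' could be the other root t - a. *)
apply: (@lrmorphism_factor _ _ _ _ (fieldExt_horner r) (fieldExt_horner (a%:A : L'))).
  exact: quad_gen_surj gen.
move=> q /=; rewrite ra /fieldExt_horner /horner_morph -!in_algE !horner_map /=.
by move/eqP; rewrite scaler_eq0 oner_eq0 orbF => /eqP->; rewrite scale0r.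
Qed.

Lemma quad_gen_iso t n L L' (r : L) (r' : L') :
  quad_gen t n r -> quad_gen t n r' -> k_isomorphic L L'.
Proof.
move=> gen gen'; have [f] := quad_gen_hom gen gen'.1.
by have [g] := quad_gen_hom gen' gen.1; apply: k_isomorphic_of_homs f g.
Qed.

Lemma quad_gen_transport t n L L' (r : L) :
  quad_gen t n r -> k_isomorphic L L' -> exists r' : L', quad_gen t n r'.
Proof.
move=> gen [f [g fK gK]]; have falg (c : k) : f c%:A = c%:A.
  by rewrite linearZ /= rmorph1.
exists (f r); split.
  by rewrite -(falg t) -raddfB -rmorphM gen.1; exact: falg.
apply/eqP; rewrite eqEsubv subvf; apply/subvP => x _.
have [q /eqP e] := quad_gen_surj gen (g x); rewrite -[x]gK -e.
apply/Fadjoin1_polyP; exists q.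
rewrite /fieldExt_horner /horner_morph -horner_map -map_poly_comp; congr (_.[_]).
by apply: eq_map_poly => c /=; rewrite falg.
Qed.

Lemma quad_gen_split t n L (r : L) :
  quad_gen t n r -> r \in 1%VS -> {:L}%VS = 1%VS.
Proof. by move=> [_ <-] /Fadjoin_idP ->. Qed.

(** If r is not in k, then r' = a + b r, and the equation of r' is compared in the basis 1, r.
    Otherwise L = k, and the affine map is the one sending the roots x, t - x to y, t' - y; its
    slope is the ratio of the root differences, non-zero as their squares are the discriminants. *)
Lemma quad_gen_affine t n t' n' L (r r' : L) :
  t ^+ 2 - 4 * n != 0 -> t' ^+ 2 - 4 * n' != 0 ->
  quad_gen t n r -> quad_gen t' n' r' ->
  exists a b : k, [/\ b != 0, t' = 2 * a + b * t
                    & n' = a ^+ 2 + a * b * t + b ^+ 2 * n].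
Proof.
move=> d d' gen gen'.
have [r1|r1] := boolP (r \in 1%VS).
  have [x xE] := vlineP _ _ r1.
  have /vlineP[y yE] : r' \in 1%VS.
    by rewrite -(quad_gen_split gen r1) memvf.
  have inj : injective (fun z : k => z%:A : L) by exact: (fmorph_inj (in_alg L)).
  have nE : n = x * (t - x).
    by apply: inj; rewrite -gen.1 xE alg_mul alg_sub.
  have n'E : n' = y * (t' - y).
    by apply: inj; rewrite -gen'.1 yE alg_mul alg_sub.
  have u0 : 2 * x - t != 0.
    by apply: contraNneq d => u0; rewrite nE; apply/eqP;
      rewrite [LHS](_ : _ = (2 * x - t) ^+ 2); [rewrite u0 expr0n | ring].
  have v0 : 2 * y - t' != 0.
    by apply: contraNneq d' => v0; rewrite n'E; apply/eqP;
      rewrite [LHS](_ : _ = (2 * y - t') ^+ 2); [rewrite v0 expr0n | ring].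
  pose b := (2 * y - t') / (2 * x - t).
  have bE : t' = 2 * y - b * (2 * x - t) by rewrite divfK //; ring.
  exists (y - b * x), b; split; first by rewrite mulf_neq0 ?invr_eq0.
    by rewrite {1}bE; ring.
  by rewrite n'E nE bE; ring.
have [a [b r'E]] := quad_gen_span gen r'; exists a, b.
have b0 : b != 0.
  apply: contraNneq r1 => b0; have r'1 : r' \in 1%VS.
    by apply/vlineP; exists a; rewrite r'E b0 scale0r addr0.
  by rewrite -(quad_gen_split gen' r'1) memvf.
have e : (a * t' - a ^+ 2 - n' + b ^+ 2 * n)%:A + (b * (t' - 2 * a - b * t)) *: r = 0.
  move: gen.1 gen'.1; rewrite r'E.
  rewrite !scale_algE ?mulr1 !in_algE => e e'.
  rewrite !(expr2, alg_sub, alg_add, alg_mul) -e -e'.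
  by rewrite !scale1r; ring.
have [e1 /eqP] := alg_indep r1 e.
rewrite mulf_eq0 (negPf b0) /= => /eqP e2.
have t'E : t' = 2 * a + b * t by apply/eqP; rewrite -subr_eq0 opprD addrA e2.
split=> //; apply/eqP; rewrite eq_sym -subr_eq0 -e1 t'E; apply/eqP; ring.
Qed.
End QuadraticFields.

(** * Semistable pairs and extensions of degree at most 2 *)

Section RootFieldCorrespondence.
Variable k : fieldType.
Implicit Types (L : fieldExtType k) (t n : k) (M : tensM k 2).

Definition monic_tens t n : tensM k 2 := tens2 1%:M (companion2 (- t) n).

Lemma polar_monic_tens t n : polar 1%:M (companion2 (- t) n) = - t.
Proof. by rewrite /polar /bdet !mxE /=; ring. Qed.

Lemma det_companion2 t n : \det (companion2 t n) = n.
Proof. by rewrite det_mx22E mul0r sub0r mulr1 opprK. Qed.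

Lemma semistable_monic t n :
  semistable (monic_tens t n) <-> t ^+ 2 - 4 * n != 0.
Proof.
rewrite /semistable disc2_det_form tens2_0 tens2_1 polar_monic_tens.
by rewrite det1 det_companion2 sqrrN mulr1.
Qed.

Lemma semistable_orbit M N :
  same_GL2cube_orbit M N -> semistable M -> semistable N.
Proof.
move=> [h [g [g' [uh ug ug' ->]]]] ss; rewrite /semistable disc2_act.
by rewrite mulf_neq0 // expf_neq0 // !mulf_neq0 // -unitfE -unitmxE.
Qed.

Lemma orbit_monic_tens M : semistable M -> exists t n,
  t ^+ 2 - 4 * n != 0 /\ same_GL2cube_orbit M (monic_tens t n).
Proof.
move=> ss; have [t [n o]] := semistable_normal_form ss.
exists (- t), n; rewrite /monic_tens opprK; split=> //.
by apply/semistable_monic; rewrite /monic_tens opprK; apply: semistable_orbit o ss.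
Qed.

Lemma root_field_monic t n L :
  root_field (det_form (monic_tens t n)) L <-> exists r : L, quad_gen t n r.
Proof.
split=> [/root_fieldP[s [u]] | [r [e gen]]].
  rewrite tens2_0 tens2_1 polar_monic_tens det1 det_companion2 scale1r.
  move=> [e0 e1 e2 gen]; exists (s 0 / u 0).
  have u0 : u 0 != 0 by apply: contra_eq_neq e0 => ->; rewrite mul0r oner_eq0.
  have u1 : u 1 != 0 by apply: contra_eq_neq e0 => ->; rewrite mulr0 oner_eq0.
  have te : t%:A = s 0 / u 0 + s 1 / u 1.
    rewrite addf_div // -e0 divr1 -[LHS]opprK -scaleNr e1 opprK; ring.
  have r1E : s 1 / u 1 = t%:A - s 0 / u 0 by rewrite te addrC addKr.
  split; first by rewrite -r1E mulf_div -e0 divr1 e2.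
  rewrite -gen adjoin_cons adjoin_seq1 r1E; apply/esym/Fadjoin_idP.
  by rewrite rpredB ?memv_adjoin // (subvP (subv_adjoin _ _)) ?rpredZ ?mem1v.
apply/root_fieldP; exists (fun i => if i == 0 then r else t%:A - r), (fun=> 1).
rewrite tens2_0 tens2_1 polar_monic_tens det1 det_companion2 /= !divr1 mulr1.
split=> //; first by rewrite scale1r.
  by rewrite scaleNr mul1r mulr1 subrK.
rewrite adjoin_cons adjoin_seq1 -gen; apply/Fadjoin_idP.
by rewrite rpredB ?memv_adjoin // (subvP (subv_adjoin _ _)) ?rpredZ ?mem1v.
Qed.

(* The matrix [a + b T], with [T] the companion matrix, is conjugate to its
   own companion matrix, via the basis [e, (a + b T) e]. *)
Lemma monic_tens_affine a b t n : b != 0 ->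
  same_GL2cube_orbit (monic_tens t n)
    (monic_tens (2 * a + b * t) (a ^+ 2 + a * b * t + b ^+ 2 * n)).
Proof.
move=> b0; pose P := mx22 1 (- a) 0 b.
have uP : P \in unitmx by rewrite unitmx22 mul1r mulr0 subr0.
exists (mx22 1 0 (- a) b), (invmx P), P^T.
rewrite unitmx22 mul1r mul0r subr0 b0 unitmx_inv unitmx_tr uP; split=> //.
rewrite tensM_act2 tens2_0 tens2_1 trmxK !mxE /=; apply: tens2P.
  by rewrite !tens2_0 scale1r scale0r addr0 mulmx1 mulVmx.
rewrite !tens2_1 -mulmxA; apply: (canRL (mulKmx uP)).
by apply: mx22P; rewrite !mxE !big_I2 !mxE /=; ring.
Qed.

Lemma root_field_exists M : semistable M ->
  exists L : fieldExtType k, root_field (det_form M) L.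
Proof.
move=> /orbit_monic_tens[t [n [_ o]]].
suff [L [r gen]] : exists (L : fieldExtType k) (r : L), quad_gen t n r.
  exists L; apply: root_field_orbit (same_GL2cube_orbit_sym o) _.
  by apply/root_field_monic; exists r.
pose p : {poly k} := 'X * ('X - t%:P) + n%:P.
have szp : size p = 3%N.
  rewrite size_polyDl size_mul ?polyX_eq0 ?polyXsubC_eq0 // size_polyX size_XsubC //.
  by rewrite size_polyC; case: (n == 0).
have rootE (L : fieldExtType k) (r : L) :
    root (map_poly (in_alg L) p) r -> r * (t%:A - r) = n%:A.
  rewrite /root rmorphD rmorphM rmorphB /= map_polyX !map_polyC /= !hornerE.
  by rewrite addrC addr_eq0 -mulrN opprB => /eqP->.
(* A quadratic polynomial without roots in k is irreducible; the existence of a root is not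
   decidable over a general field, hence [classic]. *)
have [[a pa]|nroot] := classic (exists a, root p a).
  exists k^o, a; split; first by apply: rootE; rewrite -[a]mulr1 fmorph_root.
  by rewrite regular_fullv; apply/Fadjoin_idP/vlineP; exists a; rewrite [RHS]mulr1.
have [|L _ [r pr gen]] := @irredp_FAdjoin _ p.
  apply: cubic_irreducible; first by rewrite szp.
  by move=> x; apply/negP => px; apply: nroot; exists x.
by exists L, r; split=> //; apply: rootE.
Qed.

Lemma quad_disc t n L (r : L) : r * (t%:A - r) = n%:A ->
  (t ^+ 2 - 4 * n)%:A = (r - (t%:A - r)) ^+ 2.
Proof. by move=> e; rewrite alg_sub !alg_mul scaler_nat -e; ring. Qed.

(** r is a root of (X - r) (X - (t - r)), which is defined over k and has distinct roots because its
    discriminant is the square of their difference. *)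
Lemma quad_gen_Ex2 t n L (r : L) : t ^+ 2 - 4 * n != 0 -> quad_gen t n r -> Ex2 L.
Proof.
move=> d gen; have [e genL] := gen.
pose p := \prod_(x <- [:: r; t%:A - r]) ('X - x%:P).
have pE : p = 'X^2 - t%:A *: 'X + n%:A%:P.
  rewrite /p big_cons big_seq1 -e -mul_polyC polyCM polyCB; ring.
have p1 : p \is a polyOver 1%VS.
  rewrite pE rpredD ?rpredB ?rpredX ?polyOverX ?polyOverC ?rpredZ ?mem1v //.
  by rewrite polyOverZ ?polyOverX // rpredZ ?mem1v.
have pr : root p r by rewrite root_prod_XsubC mem_head.
have szp : size p = 3%N by rewrite size_prod_XsubC.
split.
  rewrite -genL -adjoin_separable_eq; apply/separable_elementP; exists p; split=> //.
  rewrite separable_prod_XsubC /= inE andbT; apply: contraNneq d => rE.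
  by rewrite -(fmorph_eq0 (in_alg L)) /= (quad_disc e) -rE subrr expr0n.
have := dvdp_leq _ (minPoly_dvdp p1 pr); rewrite szp size_minPoly -size_poly_eq0 szp.
by rewrite adjoin_degreeE genL dimv1 divn1; apply.
Qed.

Lemma Ex2_quad_gen L : Ex2 L ->
  exists t n (r : L), t ^+ 2 - 4 * n != 0 /\ quad_gen t n r.
Proof.
move=> [sep dL].
have [/eqP d1|d1] := boolP (\dim {:L} == 1%N).
  (* For L = k, the polynomial X^2 - X has discriminant 1 in every characteristic. *)
  exists 1, 0, 0; split; first by rewrite expr1n mulr0 subr0 oner_neq0.
  split; first by rewrite mul0r scale0r.
  by rewrite Fadjoin0; apply/eqP; rewrite eqEdim subvf dimv1 d1.
have /subvPn[r _ r1] : ~~ ({:L} <= 1)%VS.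
  by apply: contra d1 => s1; rewrite eqn_leq adim_gt0 andbT (leq_trans (dimvS s1)) ?dimv1.
have gen : <<1; r>>%VS = {:L}%VS.
  apply/eqP; rewrite eqEdim subvf (leq_trans dL) //.
  rewrite ltnNge; apply: contra r1 => d; apply/Fadjoin_idP/esym/eqP.
  by rewrite eqEdim subv_adjoin dimv1.
have szp : size (minPoly 1 r) = 3%N.
  rewrite size_minPoly adjoin_degreeE gen dimv1 divn1; congr _.+1.
  by apply/eqP; rewrite eqn_leq dL ltn_neqAle eq_sym d1 adim_gt0.
have pm := monic_minPoly 1 r; have p1 := minPolyOver 1 r.
have [c1 c1E] := vlineP _ _ (polyOverP p1 1%N).
have [c0 c0E] := vlineP _ _ (polyOverP p1 0%N).
have pE : minPoly 1 r = 'X^2 + c1%:A *: 'X + c0%:A%:P.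
  move: (minPoly 1 r) szp pm c1E c0E => m szm /monicP lm c1E c0E.
  apply/polyP => i; rewrite !coefD coefXn coefZ coefX coefC.
  case: i => [|[|[|i]]] /=; rewrite ?mulr0 ?mulr1 ?add0r ?addr0 //.
    by rewrite -lm /lead_coef szm.
  by rewrite nth_default // szm.
have e : r * ((- c1)%:A - r) = c0%:A.
  have := minPolyxx 1 r; rewrite pE !hornerE => /eqP; rewrite addr_eq0 => /eqP p0.
  by rewrite -[RHS]opprK -p0 scaleNr; ring.
exists (- c1), c0, r; do 2?split=> //.
have : separable_element 1 r by rewrite adjoin_separable_eq gen.
rewrite /separable_element.
have -> : minPoly 1 r = \prod_(x <- [:: r; (- c1)%:A - r]) ('X - x%:P).
  rewrite pE big_cons big_seq1 -e scaleNr -mul_polyC polyCM !polyCB polyCN; ring.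
rewrite separable_prod_XsubC /= inE andbT; apply: contraNneq => d.
have : (r - ((- c1)%:A - r)) ^+ 2 = 0 :> L.
  by rewrite -(quad_disc e) d scale0r.
by move/eqP; rewrite expf_eq0 /= subr_eq0.
Qed.

Theorem root_field_correspondence :
  induces_quotient_bijection
    (@semistable k) (@same_GL2cube_orbit k) (@Ex2 k) (@k_isomorphic k)
    (fun M L => root_field (det_form M) L).
Proof.
split; first exact: root_field_exists.
- move=> M L /orbit_monic_tens[t [n [d o]]] /(root_field_orbit o).
  by move=> /root_field_monic[r]; apply: quad_gen_Ex2.
- move=> M M' L L' /orbit_monic_tens[t [n [d o]]] /orbit_monic_tens[t' [n' [d' o']]].
  move=> rM rM'; have /root_field_monic[r genr] := root_field_orbit o rM.
  split=> [oMM'|iso].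
    have /root_field_monic[r' gen'] : root_field (det_form (monic_tens t n)) L'.
      apply: root_field_orbit rM'.
      exact: same_GL2cube_orbit_trans (same_GL2cube_orbit_sym oMM') o.
    exact: quad_gen_iso genr gen'.
  (* The generator is carried to L', so that both generators lie in one field. *)
  have [r1 gen1] := quad_gen_transport genr iso.
  have /root_field_monic[r' gen'] := root_field_orbit o' rM'.
  have [a [b [b0 t'E n'E]]] := quad_gen_affine d d' gen1 gen'.
  apply: same_GL2cube_orbit_trans o _; apply: same_GL2cube_orbit_sym.
  apply: same_GL2cube_orbit_trans o' _; rewrite t'E n'E.
  exact/same_GL2cube_orbit_sym/monic_tens_affine.
move=> L /Ex2_quad_gen[t [n [r [d gen]]]].
exists (monic_tens t n); split; first exact/semistable_monic.
exists L; split; first by apply/root_field_monic; exists r.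
exact: (quad_gen_iso gen gen).
Qed.
End RootFieldCorrespondence.

(** * The fibres of Phi *)

Lemma det_mx33 (R : comNzRingType) (A : 'M[R]_3) :
  \det A = A 0 0 * (A 1 1 * A 2 2 - A 1 2 * A 2 1)
         - A 0 1 * (A 1 0 * A 2 2 - A 1 2 * A 2 0)
         + A 0 2 * (A 1 0 * A 2 1 - A 1 1 * A 2 0).
Proof.
rewrite (expand_det_row _ 0) big_I3 /cofactor !det_mx22 !mxE /=.
have [-> -> ->] : [/\ lift 0 0 = 1 :> 'I_3, lift 0 1 = 2 :> 'I_3 & lift 1 0 = 0 :> 'I_3].
  by split; apply: val_inj.
have [-> -> ->] : [/\ lift 1 1 = 2 :> 'I_3, lift 2 0 = 0 :> 'I_3 & lift 2 1 = 1 :> 'I_3].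
  by split; apply: val_inj.
by rewrite expr0 expr1 expr2; ring.
Qed.

Section Orbits.
Variable k : fieldType.

(** In the basis e_i dual to p_i, the matrix of wedge^2 g is the cofactor matrix of g. *)
Lemma wedge2_mx_cofactor (g : 'M[k]_3) : (wedge2_mx g)^T *m g = (\det g)%:M.
Proof.
have e01 : 0 + 1 = 1 :> 'I_3 by exact: val_inj.
have e02 : 0 + 2 = 2 :> 'I_3 by exact: val_inj.
have e11 : 1 + 1 = 2 :> 'I_3 by exact: val_inj.
have e12 : 1 + 2 = 0 :> 'I_3 by exact: val_inj.
have e21 : 2 + 1 = 0 :> 'I_3 by exact: val_inj.
have e22 : 2 + 2 = 1 :> 'I_3 by exact: val_inj.
have I3E := (e01, e02, e11, e12, e21, e22).
apply/matrixP; elim/I3_ind; elim/I3_ind;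
  by rewrite !mxE big_I3 !mxE !I3E ?mxE det_mx33 /= ?mulr1n ?mulr0n; ring.
Qed.

Lemma wedge2_mx1 : wedge2_mx 1%:M = 1%:M :> 'M[k]_3.
Proof. by apply: trmx_inj; rewrite -[LHS]mulmx1 wedge2_mx_cofactor det1 trmx1. Qed.

Lemma wedge2_mxM (g h : 'M[k]_3) : g \in unitmx -> h \in unitmx ->
  wedge2_mx (g *m h) = wedge2_mx g *m wedge2_mx h.
Proof.
move=> ug uh; have ugh : g *m h \in unitmx by rewrite unitmx_mul ug.
apply/trmx_inj/(can_inj (mulmxK ugh)); rewrite wedge2_mx_cofactor trmx_mul.
rewrite mulmxA -(mulmxA _ _ g) wedge2_mx_cofactor mul_mx_scalar -scalemxAl.
by rewrite wedge2_mx_cofactor det_mulmx scale_scalar_mx.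
Qed.

Lemma unitmx_wedge2 (g : 'M[k]_3) : g \in unitmx -> wedge2_mx g \in unitmx.
Proof.
move=> ug; have [] := @mulmx1_unit _ _ (wedge2_mx g) (wedge2_mx (invmx g)) => //.
by rewrite -wedge2_mxM ?unitmx_inv // mulmxV // wedge2_mx1.
Qed.

Lemma V_act1 (x : V k) : V_act 1%:M 1%:M 1%:M 1%:M x = x.
Proof.
rewrite /V_act tensM_act1 wedge2_mx1 trmx1.
by rewrite mul1mx mulmx1; case: x.
Qed.

Lemma V_actA g1 g2 g3 g4 h1 h2 h3 h4 (x : V k) :
  g1 \in unitmx -> h1 \in unitmx ->
  V_act g1 g2 g3 g4 (V_act h1 h2 h3 h4 x) =
  V_act (g1 *m h1) (g2 *m h2) (g3 *m h3) (g4 *m h4) x.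
Proof.
move=> ug uh; rewrite /V_act /= tensM_actA; congr pair.
by rewrite wedge2_mxM // trmx_mul !mulmxA.
Qed.

Lemma same_G_orbit_sym (x y : V k) : same_G_orbit x y -> same_G_orbit y x.
Proof.
move=> [g1 [g2 [g3 [g4 [u1 u2 u3 u4 ->]]]]].
exists (invmx g1), (invmx g2), (invmx g3), (invmx g4); rewrite !unitmx_inv.
by split=> //; rewrite V_actA ?unitmx_inv // !mulVmx // V_act1.
Qed.

Lemma same_G_orbit_trans (x y z : V k) :
  same_G_orbit x y -> same_G_orbit y z -> same_G_orbit x z.
Proof.
move=> [g1 [g2 [g3 [g4 [u1 u2 u3 u4 ->]]]]] [h1 [h2 [h3 [h4 [v1 v2 v3 v4 ->]]]]].
exists (h1 *m g1), (h2 *m g2), (h3 *m g3), (h4 *m g4).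
by rewrite !unitmx_mul u1 u2 u3 u4 v1 v2 v3 v4 V_actA.
Qed.

Lemma PhiE (x : V k) j : Phi x j = \sum_l x.1 l j *: x.2 l.
Proof.
rewrite ffunE; apply: eq_bigr => l _; rewrite /wedge21 (bigD1 l) //= big1.
  by rewrite !mxE !eqxx mulr1 addr0.
by move=> i /negPf nil; rewrite !mxE nil mulr0.
Qed.

(** The pairing of wedge^2 A^3 with A^3 is multiplied by [\det g1], by the cofactor identity; this
    scalar is moved into [g4]. *)
Lemma Phi_act g1 g2 g3 g4 (x : V k) :
  Phi (V_act g1 g2 g3 g4 x) = tensM_act (\det g1 *: g4) g2 g3 (Phi x).
Proof.
apply/ffunP => j; rewrite PhiE tensM_actE.
transitivity (g2 *m (\sum_m (\det g1 *: (x.1 *m g4^T)) m j *: x.2 m) *m g3^T).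
  under eq_bigr do rewrite /= tensM_actE scalemxAl scalemxAr scaler_sumr.
  rewrite -mulmx_suml -mulmx_sumr exchange_big /=; congr (_ *m _ *m _).
  apply: eq_bigr => m _; under eq_bigr do rewrite scalerA.
  rewrite -scaler_suml; congr (_ *: _).
  transitivity (((x.1 *m g4^T)^T *m ((wedge2_mx g1)^T *m g1)) j m).
    rewrite mulmxA -trmx_mul mulmxA mxE.
    by apply: eq_bigr => l _; rewrite [in RHS]mxE.
  by rewrite wedge2_mx_cofactor mul_mx_scalar !mxE.
congr (_ *m _ *m _).
transitivity (\sum_m \sum_i (\det g1 * g4 j i * x.1 m i) *: x.2 m).
  apply: eq_bigr => m _; rewrite -scaler_suml !mxE mulr_sumr; congr (_ *: _).
  by apply: eq_bigr => i _; rewrite mxE; ring.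
rewrite exchange_big; apply: eq_bigr => i _; rewrite PhiE mxE scaler_sumr.
by apply: eq_bigr => m _; rewrite scalerA.
Qed.
End Orbits.

(** * Reduction of the second component to a basis of sl_2 *)

Section Sl2.
Variable k : fieldType.

Definition sl2_basis : tensM k 3 :=
  [ffun i => if i == 0 then mx22 (-1) 0 0 1
             else if i == 1 then mx22 0 1 0 0 else mx22 0 0 1 0].

Definition sl2_coord (D : 'M[k]_2) (i : 'I_3) : k :=
  if i == 0 then D 1 1 else if i == 1 then D 0 1 else D 1 0.

Lemma trace2 (D : 'M[k]_2) : \tr D = D 0 0 + D 1 1.
Proof. by rewrite /mxtrace big_I2. Qed.

Lemma sl2_basisE (c : 'I_3 -> k) :
  \sum_i c i *: sl2_basis i = mx22 (- c 0) (c 1) (c 2) (c 0).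
Proof. by rewrite big_I3 !ffunE; apply: mx22P; rewrite !mxE /=; ring. Qed.

Lemma sl2_coordK (D : 'M[k]_2) : \tr D = 0 ->
  \sum_i sl2_coord D i *: sl2_basis i = D.
Proof.
move=> /eqP; rewrite trace2 addr_eq0 => /eqP D0.
by rewrite sl2_basisE; apply: mx22P; rewrite !mxE.
Qed.

Lemma tr_sl2_basis i : \tr (sl2_basis i) = 0.
Proof. by move: i; elim/I3_ind; rewrite trace2 ffunE !mxE /= ?addNr ?addr0. Qed.

(** The half-discriminant of a ternary quadratic form: half the determinant of its polar Gram
    matrix, as an integral polynomial. *)
Definition half_disc (a b c d e f : k) : k :=
  4 * a * d * f + b * c * e - a * e ^+ 2 - d * c ^+ 2 - f * b ^+ 2.

Definition P2M (B : tensM k 3) : k :=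
  half_disc (\det (B 0)) (polar (B 0) (B 1)) (polar (B 0) (B 2))
            (\det (B 1)) (polar (B 1) (B 2)) (\det (B 2)).

Lemma P2E (x : V k) : P2 x = P2M x.2.
Proof. by rewrite /P2 !qcoef_det_form. Qed.

Lemma P2M_mul g g' (B : tensM k 3) :
  P2M (tensM_act 1%:M g g' B) = (\det g * \det g') ^+ 3 * P2M B.
Proof.
rewrite /P2M !tensM_act1l !polar_mul !det_mulmx det_tr /half_disc.
move: (\det g) (\det g') (\det (B 0)) (\det (B 1)) (\det (B 2)) => u v a d f.
by move: (polar (B 0) (B 1)) (polar (B 0) (B 2)) (polar _ _) => b c e; ring.
Qed.

Lemma P2M_sl2_basis (g : 'M[k]_3) :
  P2M (tensM_act g 1%:M 1%:M sl2_basis) = \det g ^+ 2.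
Proof.
have E i : tensM_act g 1%:M 1%:M sl2_basis i = mx22 (- g i 0) (g i 1) (g i 2) (g i 0).
  by rewrite tensM_actE trmx1 mulmx1 mul1mx sl2_basisE.
rewrite /P2M /polar /bdet !E !det_mx22E !mxE /= det_mx33 /half_disc.
move: (g 0 0) (g 0 1) (g 0 2) (g 1 0) (g 1 1) (g 1 2) (g 2 0) (g 2 1) (g 2 2).
move=> *; ring.
Qed.

Lemma traceless_basis (B : tensM k 3) :
  (forall i, \tr (B i) = 0) -> P2M B != 0 ->
  exists2 g, g \in unitmx & B = tensM_act g 1%:M 1%:M sl2_basis.
Proof.
move=> B0; pose g : 'M[k]_3 := \matrix_(i, j) sl2_coord (B i) j.
have BE : B = tensM_act g 1%:M 1%:M sl2_basis.
  apply/ffunP => i; rewrite tensM_actE trmx1 mulmx1 mul1mx -[LHS]sl2_coordK //.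
  by apply: eq_bigr => j _; rewrite mxE.
rewrite {1}BE P2M_sl2_basis expf_eq0 /= => dg; exists g => //.
by rewrite unitmxE unitfE.
Qed.

Definition det3 (a b c : 'I_3 -> k) : k :=
  a 0 * (b 1 * c 2 - b 2 * c 1) - a 1 * (b 0 * c 2 - b 2 * c 0)
  + a 2 * (b 0 * c 1 - b 1 * c 0).

(* The matrix [C] such that [\tr (X *m C)] is, up to sign, the determinant of
   [B 0, B 1, B 2, X] in the basis of matrix units. *)
Definition tensM_normal (B : tensM k 3) : 'M[k]_2 :=
  let e p q i := B i p q in
  mx22 (det3 (e 0 1) (e 1 0) (e 1 1)) (det3 (e 0 0) (e 0 1) (e 1 1))
       (- det3 (e 0 0) (e 1 0) (e 1 1)) (- det3 (e 0 0) (e 0 1) (e 1 0)).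

Lemma tr_tensM_normal (B : tensM k 3) i : \tr (B i *m tensM_normal B) = 0.
Proof.
move: i; elim/I3_ind; rewrite trace2 !mxE !big_I2 !mxE /= /det3; ring.
Qed.

(** Geometrically, a nondegenerate quadratic form restricted to a hyperplane degenerates exactly
    when the normal vector is isotropic. *)
Lemma det_tensM_normal (B : tensM k 3) : \det (tensM_normal B) = P2M B.
Proof.
rewrite det_mx22E /P2M /half_disc /polar /bdet /det3 !det_mx22.
move: (B 0 0 0) (B 0 0 1) (B 0 1 0) (B 0 1 1) => a b c d.
move: (B 1 0 0) (B 1 0 1) (B 1 1 0) (B 1 1 1) => a1 b1 c1 d1.
move: (B 2 0 0) (B 2 0 1) (B 2 1 0) (B 2 1 1) => a2 b2 c2 d2.
ring.
Qed.

Lemma P2_normal_form (x : V k) : P2 x != 0 ->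
  exists A, same_G_orbit (A, sl2_basis) x.
Proof.
rewrite P2E => P2x; set C := tensM_normal x.2.
have uC : C \in unitmx by rewrite unitmxE unitfE det_tensM_normal.
pose D := tensM_act 1%:M 1%:M C^T x.2.
have [|| g ug Dg] := @traceless_basis D.
- by move=> i; rewrite tensM_act1l mul1mx trmxK tr_tensM_normal.
- rewrite P2M_mul mulf_neq0 // expf_neq0 // mulf_neq0 ?det1 ?oner_eq0 //.
  by rewrite -unitfE -unitmxE unitmx_tr.
(* The first component is chosen to undo the action of wedge^2 g. *)
exists (invmx (wedge2_mx g) *m x.1), g, 1%:M, (invmx C^T), 1%:M.
rewrite unitmx_inv unitmx_tr unitmx1; split=> //.
rewrite /V_act /= trmx1 mulmx1 mulKVmx ?unitmx_wedge2 //.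
have -> : tensM_act g 1%:M (invmx C^T) sl2_basis = x.2; last by case: (x).
transitivity (tensM_act 1%:M 1%:M (invmx C^T) D); last first.
  by rewrite tensM_actA mulVmx ?unitmx_tr // !mulmx1 tensM_act1.
by rewrite Dg tensM_actA !mul1mx mulmx1.
Qed.
End Sl2.
Arguments sl2_basis {k}.

(** * Equivalence of traceless pairs *)

Section Fibres.
Variable k : fieldType.

(** (n0, n1, n2) is the cross product, which spans the orthogonal of two independent vectors. *)
Lemma cross_collinear (z0 z1 z2 a0 b0 c0 a1 b1 c1 : k) :
  a0 * z0 + b0 * z1 + c0 * z2 = 0 -> a1 * z0 + b1 * z1 + c1 * z2 = 0 ->
  let n0 := b0 * c1 - c0 * b1 in let n1 := c0 * a1 - a0 * c1 in
  let n2 := a0 * b1 - b0 * a1 in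
  [\/ n0 != 0, n1 != 0 | n2 != 0] ->
  exists d, [/\ z0 = d * n0, z1 = d * n1 & z2 = d * n2].
Proof.
move=> e0 e1 n0 n1 n2.
have c01 : z0 * n1 = z1 * n0.
  apply/eqP; rewrite -subr_eq0; apply/eqP.
  transitivity (c0 * (a1 * z0 + b1 * z1 + c1 * z2)
              - c1 * (a0 * z0 + b0 * z1 + c0 * z2)); last by rewrite e0 e1; ring.
  rewrite /n0 /n1; ring.
have c02 : z0 * n2 = z2 * n0.
  apply/eqP; rewrite -subr_eq0; apply/eqP.
  transitivity (b1 * (a0 * z0 + b0 * z1 + c0 * z2)
              - b0 * (a1 * z0 + b1 * z1 + c1 * z2)); last by rewrite e0 e1; ring.
  rewrite /n0 /n2; ring.
have c12 : z1 * n2 = z2 * n1.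
  apply/eqP; rewrite -subr_eq0; apply/eqP.
  transitivity (a0 * (a1 * z0 + b1 * z1 + c1 * z2)
              - a1 * (a0 * z0 + b0 * z1 + c0 * z2)); last by rewrite e0 e1; ring.
  rewrite /n1 /n2; ring.
case=> n; [exists (z0 / n0) | exists (z1 / n1) | exists (z2 / n2)]; split.
- by rewrite divfK.
- by rewrite mulrAC c01 mulfK.
- by rewrite mulrAC c02 mulfK.
- by rewrite mulrAC -c01 mulfK.
- by rewrite divfK.
- by rewrite mulrAC c12 mulfK.
- by rewrite mulrAC -c02 mulfK.
- by rewrite mulrAC -c12 mulfK.
by rewrite divfK.
Qed.

(* For traceless [M i], the matrices [X] with [\tr (M i *m X) = 0] are spanned
   by [1] and [M 0 *m M 1], and right multiplication by these preserves the
   span of [M 0] and [M 1], since [M 0] and [M 1] anticommute up to a scalar. *)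
Lemma traceless_pencil_mul (M : tensM k 2) (X : 'M[k]_2) :
  semistable M -> X \in unitmx ->
  (forall i, \tr (M i) = 0) -> (forall i, \tr (M i *m X) = 0) ->
  exists2 h, h \in unitmx & tensM_act 1%:M 1%:M X^T M = tensM_act h 1%:M 1%:M M.
Proof.
move=> ss uX M0 MX.
suff [h hE] : exists h, tensM_act 1%:M 1%:M X^T M = tensM_act h 1%:M 1%:M M.
  (* Comparing discriminants gives [\det h ^+ 2 = \det X ^+ 2], so h is invertible. *)
  exists h => //; have := disc2_act 1%:M 1%:M X^T M.
  rewrite hE disc2_act !det1 !mulr1 !mul1r det_tr => /(mulIf ss) e.
  by rewrite unitmxE unitfE -sqrf_eq0 e sqrf_eq0 -unitfE -unitmxE.
have m0 i : M i 0 0 = - M i 1 1.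
  by have /eqP := M0 i; rewrite trace2 addr_eq0 => /eqP.
(* These coordinates describe X modulo scalars; each trace condition is one linear equation in them.
   The cross product is non-zero since the discriminant is n0^2 + 4 n1 n2. *)
have [] := @cross_collinear (X 1 1 - X 0 0) (X 1 0) (X 0 1)
  (M 0 1 1) (M 0 0 1) (M 0 1 0) (M 1 1 1) (M 1 0 1) (M 1 1 0).
- rewrite -[RHS](MX 0) trace2 !mxE !big_I2 m0; ring.
- rewrite -[RHS](MX 1) trace2 !mxE !big_I2 m0; ring.
- set n0 := _ - _; set n1 := _ - _; set n2 := _ - _.
  have [/= e0|?] := eqVneq n0 0; last by constructor 1.
  have [/= e1|?] := eqVneq n1 0; last by constructor 2.
  have [/= e2|?] := eqVneq n2 0; last by constructor 3.
  case/negP: ss; rewrite disc2_det_form /polar /bdet !det_mx22 !m0.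
  rewrite [X in X == 0](_ : _ = n0 ^+ 2 + 4 * n1 * n2).
    by rewrite e0 e1 expr0n mulr0 mul0r addr0.
  rewrite /n0 /n1 /n2; ring.
move=> d [z0 z1 z2].
(* [X = c - d M_0 M_1] *)
pose c := X 0 0 + d * (M 0 1 1 * M 1 1 1 + M 0 0 1 * M 1 1 0).
(* The rows come from M_i^2 = - det M_i and M_0 M_1 + M_1 M_0 = tr (M_0 M_1). *)
exists (mx22 c (d * \det (M 0)) (- d * \det (M 1)) (c - d * \tr (M 0 *m M 1))).
have x11 : X 1 1 = X 0 0 + d * (M 0 0 1 * M 1 1 0 - M 0 1 0 * M 1 0 1).
  by rewrite -z0 subrKC.
apply: tens2P; rewrite !tensM_act2 ?tens2_0 ?tens2_1 !mul1mx !trmx1 !mulmx1 trmxK;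
  apply: mx22P; rewrite !mxE !big_I2 !det_mx22 ?trace2 ?mxE ?big_I2 ?mxE /= !m0;
  rewrite /c ?z1 ?z2 ?x11; ring.
Qed.

Lemma Phi_sl2_basis_surj (M : tensM k 2) : (forall i, \tr (M i) = 0) ->
  exists A, Phi (A, sl2_basis) = M.
Proof.
move=> M0; exists (\matrix_(l, j) sl2_coord (M j) l); apply/ffunP => j.
rewrite PhiE /= -[RHS]sl2_coordK //.
by apply: eq_bigr => l _; rewrite mxE.
Qed.

Lemma Phi_sl2_basis_inj (A A' : 'M[k]_(3, 2)) :
  Phi (A, sl2_basis) = Phi (A', sl2_basis) -> A = A'.
Proof.
move=> /ffunP e; apply/matrixP => l j; have := e j.
rewrite !PhiE /= !sl2_basisE => /matrixP {}e.
by move: l; elim/I3_ind; [have := e 1 1 | have := e 0 1 | have := e 1 0]; rewrite !mxE.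
Qed.

Lemma tr_Phi_sl2_basis A i : \tr (Phi (A, sl2_basis) i : 'M[k]_2) = 0.
Proof.
rewrite PhiE raddf_sum big1 // => l _ /=.
by rewrite linearZ /= tr_sl2_basis mulr0.
Qed.

(** Conjugation preserves tracelessness and P_2, so it yields another basis of sl_2, which GL_3
    carries back. *)
Lemma sl2_basis_conj (g : 'M[k]_2) : g \in unitmx -> exists2 g1,
  g1 \in unitmx & tensM_act g1 g (invmx g)^T sl2_basis = sl2_basis.
Proof.
move=> ug; pose B := tensM_act 1%:M g (invmx g)^T sl2_basis.
have [|| g1 ug1 BE] := @traceless_basis _ B.
- move=> i; rewrite tensM_actE trmxK mxtrace_mulC mulmxA mulVmx // mul1mx.
  by rewrite raddf_sum big1 // => l _ /=; rewrite linearZ /= tr_sl2_basis mulr0.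
- rewrite P2M_mul det_tr -det_mulmx mulmxV // det1 expr1n mul1r.
  by rewrite -[sl2_basis]tensM_act1 P2M_sl2_basis det1 expr1n oner_neq0.
exists (invmx g1); first by rewrite unitmx_inv.
transitivity (tensM_act (invmx g1) 1%:M 1%:M B).
  by rewrite tensM_actA !mul1mx mulmx1.
by rewrite BE tensM_actA mulVmx // !mul1mx tensM_act1.
Qed.

Lemma Phi_fibre (A A' : 'M[k]_(3, 2)) :
  semistable (Phi (A, sl2_basis)) ->
  same_GL2cube_orbit (Phi (A, sl2_basis)) (Phi (A', sl2_basis)) ->
  same_G_orbit (A, sl2_basis) (A', sl2_basis).
Proof.
move=> ss [h [g [g' [uh ug ug' e]]]].
set M := tensM_act h 1%:M 1%:M (Phi (A, sl2_basis)).
have ssM : semistable M.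
  by apply: semistable_orbit ss; exists h, 1%:M, 1%:M; rewrite unitmx1.
have MN : Phi (A', sl2_basis) = tensM_act 1%:M g g' M.
  by rewrite e tensM_actA mul1mx !mulmx1.
have [||i|i|h' uh' hE] := @traceless_pencil_mul M (g'^T *m g) => //.
- by rewrite unitmx_mul unitmx_tr ug ug'.
- rewrite tensM_actE trmx1 mulmx1 mul1mx raddf_sum big1 // => l _ /=.
  by rewrite linearZ /= tr_Phi_sl2_basis mulr0.
- by rewrite mulmxA mxtrace_mulC mulmxA -tensM_act1l -MN tr_Phi_sl2_basis.
have [g1 ug1 wE] := sl2_basis_conj ug.
have d0 : \det g1 != 0 by rewrite -unitfE -unitmxE.
(* The inverse cancels the determinant that [Phi_act] introduces. *)
pose g4 := (\det g1)^-1 *: (h' *m h).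
have gE : Phi (V_act g1 g (invmx g)^T g4 (A, sl2_basis)) = Phi (A', sl2_basis).
  rewrite Phi_act scalerA divff // scale1r MN.
  (* g M_i g'^T is the conjugate by g of M_i X with X = g'^T g; right multiplication by X is
     replaced by h'. *)
  transitivity (tensM_act 1%:M g (invmx g)^T (tensM_act 1%:M 1%:M (g'^T *m g)^T M)).
    by rewrite hE !tensM_actA !mul1mx !mulmx1.
  rewrite tensM_actA !mul1mx !mulmx1 trmx_mul trmxK mulmxA -trmx_mul mulmxV //.
  by rewrite trmx1 mul1mx.
exists g1, g, (invmx g)^T, g4; rewrite ug1 ug unitmx_tr unitmx_inv ug.
rewrite unitmxZ ?unitfE ?invr_eq0 // unitmx_mul uh uh'; split=> //.
by move: gE; rewrite /V_act /= wE => /Phi_sl2_basis_inj <-.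
Qed.

Theorem Phi_correspondence :
  induces_quotient_bijection
    (@U k) (@same_G_orbit k) (@semistable k) (@same_GL2cube_orbit k)
    (fun x M => M = Phi x).
Proof.
have Phi_orbit (x y : V k) :
    same_G_orbit x y -> same_GL2cube_orbit (Phi x) (Phi y).
  move=> [g1 [g2 [g3 [g4 [u1 u2 u3 u4 ->]]]]].
  exists (\det g1 *: g4), g2, g3; rewrite u2 u3 Phi_act unitmxZ //.
split.
- by move=> x _; exists (Phi x).
- by move=> x M [P1x _] ->.
- move=> x x' _ _ [P1x P2x] [P1x' P2x'] -> ->; split; first exact: Phi_orbit.
  have [A oA] := P2_normal_form P2x; have [A' oA'] := P2_normal_form P2x'.
  move=> o; apply: same_G_orbit_trans (same_G_orbit_sym oA) _.
  apply: (same_G_orbit_trans _ oA'); apply: Phi_fibre.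
    exact: semistable_orbit (Phi_orbit _ _ (same_G_orbit_sym oA)) P1x.
  apply: same_GL2cube_orbit_trans (Phi_orbit _ _ oA) _.
  exact: same_GL2cube_orbit_trans o (Phi_orbit _ _ (same_G_orbit_sym oA')).
move=> M ssM; have [t [n [_ o]]] := orbit_monic_tens ssM.
(* C is chosen so that both C and C T are traceless, T being the companion matrix. *)
pose C := mx22 1 (- t) 0 (-1).
have uC : C \in unitmx by rewrite unitmx22 mulr0 subr0 mul1r oppr_eq0 oner_eq0.
have oC : same_GL2cube_orbit M (tensM_act 1%:M C 1%:M (monic_tens t n)).
  apply: same_GL2cube_orbit_trans o _.
  by exists 1%:M, C, 1%:M; rewrite !unitmx1 uC.
have [|A PA] := @Phi_sl2_basis_surj (tensM_act 1%:M C 1%:M (monic_tens t n)).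
  by move=> i; rewrite tensM_act2 tens2_0 tens2_1 trmx1 !mulmx1; move: i;
    elim/I2_ind; rewrite trace2 ffunE /= !mxE !big_I2 !mxE /=; ring.
exists (A, sl2_basis); split.
  split; first by rewrite /P1 PA; apply: semistable_orbit oC ssM.
  by rewrite P2E /= -[sl2_basis]tensM_act1 P2M_sl2_basis det1 expr1n oner_neq0.
by exists (Phi (A, sl2_basis)); split=> //; rewrite PA; apply: same_GL2cube_orbit_sym.
Qed.
End Fibres.

Theorem proposition10p8 (k : fieldType) :
  induces_quotient_bijection
    (@U k) (@same_G_orbit k)
    (@semistable k) (@same_GL2cube_orbit k)
    (fun x M => M = Phi x)
  /\
  induces_quotient_bijection
    (@semistable k) (@same_GL2cube_orbit k)
    (@Ex2 k) (@k_isomorphic k)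
    (fun M L => root_field (det_form M) L).
Proof. by split; [apply: Phi_correspondence | apply: root_field_correspondence]. Qed.
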